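(* Assume $\mathrm{GCH}$ and Chang's conjecture $(\aleph_{\omega+1}, \aleph_\omega) \twoheadrightarrow (\aleph_1, \aleph_0)$. Then $\mathrm{KH}_{\aleph_\omega}$ fails. Also, there does not exist a family $\mathcal{F} \subseteq [\aleph_\omega]^{\aleph_0}$ with $|\mathcal{F}| \geq \aleph_{\omega+1}$ such that $\mathcal{F} \restriction X$ has size $\aleph_0$ for every $X \subseteq \aleph_\omega$ with $|X| = \aleph_0$.
   Context: For a family $\mathcal{F}$ of sets and a set $X$, $\mathcal{F} \restriction X = \{ t \cap X : t \in \mathcal{F}\}$. For an infinite cardinal $\lambda$, $\mathrm{KH}_\lambda$ is the assertion: there exists $\mathcal{F} \subseteq P(\lambda)$ with $|\mathcal{F}| > \lambda$ but $|\mathcal{F} \restriction X| \leq |X|$ for every infinite $X \subseteq \lambda$ with $|X| < \lambda$. $[\aleph_\omega]^{\aleph_0}$ denotes the set of countably infinite subsets of $\aleph_\omega$. Chang's conjecture $(\aleph_{\omega+1}, \aleph_\omega) \twoheadrightarrow (\aleph_1, \aleph_0)$ means: every first-order structure $(A, B, \ldots)$ in a countable language with $|A| = \aleph_{\omega+1}$ and a unary predicate $B \subseteq A$ with $|B| = \aleph_\omega$ has an elementary substructure $(A', B', \ldots)$ with $|A'| = \aleph_1$ and $|B'| = \aleph_0$. *)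

(* Defs.v *)
From mathcomp Require Import all_boot.
From mathcomp Require Import boolp classical_sets functions cardinality.

Set Implicit Arguments.
Unset Strict Implicit.
Unset Printing Implicit Defensive.

Local Open Scope classical_set_scope.
Local Open Scope card_scope.

(* A cardinal is represented by a type of that cardinality; all notions below
   are invariant under equinumerosity. *)

Definition card_lt (T U : Type) (A : set T) (B : set U) : Prop :=
  A #<= B /\ ~ (B #<= A).

Definition is_succ_card (T U : Type) : Prop :=
  card_lt [set: T] [set: U] /\
  forall V : Type, card_lt [set: T] [set: V] -> [set: U] #<= [set: V].

Definition is_sup_card (A : nat -> Type) (U : Type) : Prop :=
  (forall n, [set: A n] #<= [set: U]) /\
  forall V : Type, (forall n, [set: A n] #<= [set: V]) -> [set: U] #<= [set: V].

Lemma inj_card_leT (T U : Type) (f : T -> U) :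
  injective f -> [set: T] #<= [set: U].
Proof.
move=> fI; rewrite -(card_le_eql (inj_card_eq (f := f) _)).
  exact: subset_card_le.
by move=> x y _ _; exact: fI.
Qed.

Lemma card_leT_inj (T U : Type) :
  [set: T] #<= [set: U] -> exists f : T -> U, injective f.
Proof.
move=> /card_leP[f]; exists (fun x => val (f (to_setT x))) => x y /val_inj.
by move=> /(@inj _ _ _ f); rewrite !inE => /(_ I I) /(congr1 val).
Qed.

Lemma card_sig (T : Type) (A : set T) : A #= [set: {x | A x}].
Proof.
have eA : range (@sval T A) = A.
  by apply/seteqP; split=> [_ [[x Ax] _ <-]//|x Ax]; exists (exist _ x Ax).
have : range (@sval T A) #= [set: {x | A x}].
  apply: inj_card_eq => -[x Ax] [y Ay] _ _ /= xy.
  by subst y; congr exist; exact: Prop_irrelevance.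
by rewrite eA.
Qed.

Lemma exists_least_card (U : Type) (P : set (set U)) :
  P !=set0 -> exists2 S, P S & forall S', P S' -> S #<= S'.
Proof.
move=> [S0 PS0].
pose I := {S | P S}.
pose T := forall i : I, {x | sval i x}.
pose Q (X : set T) := forall i f g, X f -> X g -> f i = g i -> f = g.
have [|X [QX Xmax]] := @Zorn_bigcup T Q.
  move=> F FQ Ftot i f g [A FA Af] [B FB Bg] fg.
  have [AB|BA] := Ftot _ _ FA FB.
    by apply: (FQ _ FB i) => //; exact: AB.
  by apply: (FQ _ FA i) => //; exact: BA.
have [i Xi] : exists i : I, forall y : {x | sval i x}, exists2 f, X f & f i = y.
  apply: contrapT => noi.
  have ey : forall i : I, exists y : {x | sval i x}, ~ exists2 f, X f & f i = y.
    move=> i; apply: contrapT => noy; apply: noi; exists i => y.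
    by apply: contrapT => nof; apply: noy; exists y.
  pose y : T := fun i => sval (cid (ey i)).
  have yP i : ~ exists2 f, X f & f i = y i := svalP (cid (ey i)).
  have Xy : ~ X y by move=> Xy; apply: (yP (exist _ S0 PS0)); exists y.
  apply: (Xmax (X `|` [set y])).
    by split; [exact: subsetUl|move=> sub; apply: Xy; apply: sub; right].
  move=> i f g [Xf|->] [Xg|->] // fg; first exact: (QX i).
    by case: (yP i); exists f.
  by case: (yP i); exists g.
exists (sval i); first exact: (svalP i).
move=> S' PS'; pose j : I := exist _ S' PS'.
have [|h hP] := @choice {x | sval i x} T (fun y f => X f /\ f i = y).
  by move=> y; have [f Xf fy] := Xi y; exists f.
rewrite (card_le_eql (card_sig _)) (card_le_eqr (card_sig S')).
apply: (@inj_card_leT _ _ (fun y => h y j)) => y z hyz.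
have [Xy hy] := hP y; have [Xz hz] := hP z.
by rewrite -hy -hz (QX _ _ _ Xy Xz hyz).
Qed.

Lemma card_leT_total (T U : Type) :
  [set: T] #<= [set: U] \/ [set: U] #<= [set: T].
Proof.
have eT : range (@inl T U) #= [set: T] by apply: inj_card_eq => x y _ _ [].
have eU : range (@inr T U) #= [set: U] by apply: inj_card_eq => x y _ _ [].
pose P : set (set (T + U)) := [set range inl; range inr].
have [|S [|] -> le] := @exists_least_card _ P; first by exists (range inl); left.
  left; rewrite -(card_le_eql eT) -(card_le_eqr eU); apply: le; by right.
right; rewrite -(card_le_eql eU) -(card_le_eqr eT); apply: le; by left.
Qed.

Lemma card_set_nle (T : Type) : ~ ([set: set T] #<= [set: T]).
Proof.
move=> /card_leT_inj[g gI].
pose D : set T := [set x | exists2 A, x = g A & ~ A x].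
have nDg : ~ D (g D) by move=> Dg; case: (Dg) => A /gI <-.
by apply: (nDg); exists D.
Qed.

Lemma exists_succ_card (T : Type) : exists U : Type, is_succ_card T U.
Proof.
pose P : set (set (set T)) := [set S | ~ (S #<= [set: T])].
have [|S PS Smin] := @exists_least_card _ P.
  by exists setT; exact: card_set_nle.
exists {x | S x}; split.
  split; last by rewrite -(card_le_eql (card_sig S)).
  have [//|] := card_leT_total T {x | S x}.
  by rewrite -(card_le_eql (card_sig S)).
move=> V [_ VT]; rewrite -(card_le_eql (card_sig S)).
have [/card_leT_inj[f fI]|VS] := card_leT_total V (set T).
  have fV : range f #= [set: V] by apply: inj_card_eq => x y _ _; exact: fI.
  by rewrite -(card_le_eqr fV); apply: Smin; rewrite /P /= (card_le_eql fV).
by apply: card_le_trans VS; exact: subset_card_le.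
Qed.

Lemma exists_sup_card (A : nat -> Type) : exists U : Type, is_sup_card A U.
Proof.
pose W := {n & A n}.
pose P : set (set W) := [set S | forall n, [set: A n] #<= S].
have [|S PS Smin] := @exists_least_card _ P.
  exists setT => n; apply: (@inj_card_leT _ _ (fun a => existT A n a)) => a b.
  exact: eq_from_Tagged.
exists {x | S x}; split=> [n|V AV]; first by rewrite -(card_le_eqr (card_sig S)).
rewrite -(card_le_eql (card_sig S)).
have [/card_leT_inj[f fI]|WV] := card_leT_total V W.
  have fV : range f #= [set: V] by apply: inj_card_eq => x y _ _; exact: fI.
  by rewrite -(card_le_eqr fV); apply: Smin => n; rewrite (card_le_eqr fV).
by apply: card_le_trans WV; exact: subset_card_le.
Qed.

Definition succ_card (T : Type) : Type := sval (cid (exists_succ_card T)).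

Lemma succ_cardP (T : Type) : is_succ_card T (succ_card T).
Proof. exact: (svalP (cid (exists_succ_card T))). Qed.

Fixpoint aleph (n : nat) : Type :=
  if n is m.+1 then succ_card (aleph m) else nat.

Definition aleph_omega : Type := sval (cid (exists_sup_card aleph)).

Lemma aleph_omegaP : is_sup_card aleph aleph_omega.
Proof. exact: (svalP (cid (exists_sup_card aleph))). Qed.

Definition aleph_omega1 : Type := succ_card aleph_omega.

Definition GCH : Prop :=
  forall T : Type, infinite_set [set: T] -> [set: set T] #= [set: succ_card T].

Definition restr (T : Type) (F : set (set T)) (X : set T) : set (set T) :=
  [set t `&` X | t in F].

Definition KH (T : Type) : Prop :=
  exists F : set (set T), card_lt [set: T] F /\
    forall X : set T, infinite_set X -> card_lt X [set: T] -> restr F X #<= X.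

(* First-order logic with equality. Symbols are indexed by their arity;
   constants are the function symbols of arity 0. *)

Record language := Language {
  fsym : nat -> Type;
  rsym : nat -> Type }.

Definition countable_language (L : language) : Prop :=
  countable [set: {n & fsym L n}] /\ countable [set: {n & rsym L n}].

Record structure (L : language) (A : Type) := Structure {
  fint : forall n, fsym L n -> ('I_n -> A) -> A;
  rint : forall n, rsym L n -> ('I_n -> A) -> Prop }.

Inductive term (L : language) : Type :=
| Var of nat
| App n of fsym L n & ('I_n -> term L).

Inductive formula (L : language) : Type :=
| Equal of term L & term L
| Rel n of rsym L n & ('I_n -> term L)
| Neg of formula L
| And of formula L & formula L
| Ex of nat & formula L.

Fixpoint teval (L : language) (A : Type) (M : structure L A) (v : nat -> A)
    (t : term L) : A :=
  match t with
  | Var x => v x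
  | App n f ts => fint M f (fun i => teval M v (ts i))
  end.

Definition update (A : Type) (v : nat -> A) (x : nat) (a : A) : nat -> A :=
  fun y => if y == x then a else v y.

Fixpoint sat (L : language) (A : Type) (M : structure L A) (v : nat -> A)
    (phi : formula L) : Prop :=
  match phi with
  | Equal s t => teval M v s = teval M v t
  | Rel n r ts => rint M r (fun i => teval M v (ts i))
  | Neg psi => ~ sat M v psi
  | And psi chi => sat M v psi /\ sat M v chi
  | Ex x psi => exists a : A, sat M (update v x a) psi
  end.

Definition fclosed (L : language) (A : Type) (M : structure L A) (S : set A) :
    Prop :=
  forall n (f : fsym L n) (a : 'I_n -> A), (forall i, S (a i)) -> S (fint M f a).

Definition substructure (L : language) (A : Type) (M : structure L A)
    (S : set A) (clS : fclosed M S) : structure L {x | S x} :=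
  {| fint := fun n f a =>
       exist S (fint M f (fun i => sval (a i))) (clS n f _ (fun i => svalP (a i)));
     rint := fun n r a => rint M r (fun i => sval (a i)) |}.

Definition elementary_sub (L : language) (A : Type) (M : structure L A)
    (S : set A) : Prop :=
  exists clS : fclosed M S, forall (phi : formula L) (v : nat -> {x | S x}),
    sat (substructure clS) v phi <-> sat M (fun x => sval (v x)) phi.

Definition interp1 (L : language) (A : Type) (M : structure L A)
    (P : rsym L 1) : set A :=
  [set a | rint M P (fun=> a)].

(* Chang's conjecture (K, L) ->> (K', L'). *)
Definition Chang (K L K' L' : Type) : Prop :=
  forall (Lg : language), countable_language Lg ->
  forall (A : Type) (M : structure Lg A) (P : rsym Lg 1),
    [set: A] #= [set: K] -> interp1 M P #= [set: L] ->
    exists S : set A, [/\ elementary_sub M S, S #= [set: K'] &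
      S `&` interp1 M P #= [set: L']].

(* Main.v *)
Require Import Defs.
From mathcomp Require Import all_boot.
From mathcomp Require Import boolp classical_sets functions cardinality.

Set Implicit Arguments.
Unset Strict Implicit.
Unset Printing Implicit Defensive.

Local Open Scope classical_set_scope.
Local Open Scope card_scope.

(** Code a family [F] of subsets of [L] with [|F| >= K] as a structure on [K]:
    [L] is embedded as a unary predicate, and a binary relation says that a
    point of [L] belongs to the member of [F] named by an element of [K].
    Distinct members of [F] are told apart by a point of [L], so in an
    elementary substructure [S] they are told apart by a point of [X], the
    trace of [S] on [L].  Hence the elements of [S] name distinct members of
    [restr F X], which has therefore size at least [K'] although [X] has size
    [L'].  For [(K', L') = (aleph 1, aleph 0)] this contradicts the smallness
    of the restrictions of [F] to countable sets. *)

Definition membership_language : language :=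
  Language (fun=> void) (fun=> unit).

Lemma countable_membership_language : countable_language membership_language.
Proof. by split; exact: countableP. Qed.

(* Only the arities 1 and 2 carry information. *)
Definition membership_structure (K L : Type) (e : L -> K) (g : K -> set L) :
    structure membership_language K :=
  {| fint := fun n (f : Defs.fsym membership_language n) _ => match f with end;
     rint := fun n _ =>
       match n return ('I_n -> K) -> Prop with
       | 1 => fun a => range e (a ord0)
       | 2 => fun a => exists2 x, a ord0 = e x & g (a ord_max) x
       | _ => fun=> True
       end |}.

Definition member_formula (i j : nat) : formula membership_language :=
  @Rel membership_language 2 tt
    (fun k => Var membership_language (if k == ord0 then i else j)).

Definition separation_formula : formula membership_language :=
  Ex 0 (And (member_formula 0 1) (Neg (member_formula 0 2))).

(** [separation_formula] holds in the whole structure with witness [e x]. Elementarity provides a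
    witness inside [S], and the binary relation forces it to be some [e y]. *)
Lemma elementary_sub_separates (K L : Type) (e : L -> K) (g : K -> set L)
    (S : set K) (a b : K) (x : L) :
  injective e -> elementary_sub (membership_structure e g) S ->
  S a -> S b -> g a x -> ~ g b x -> exists y, [/\ S (e y), g a y & ~ g b y].
Proof.
move=> eI [clS elS] Sa Sb ax nbx.
(* Variable 1 names [a]; every other one, in particular 2, names [b]. *)
pose v n : {z | S z} := if n == 1 then exist S a Sa else exist S b Sb.
have [_ /(_ _)[|[c Sc] [[y /= cy ay] nby]]] := elS separation_formula v.
  exists (e x); split; first by exists x.
  by move=> [z /= /eI <-].
exists y; split=> //; first by rewrite -cy.
by move=> gby; apply: nby; exists y.
Qed.

Lemma Chang_restr_ge (K L K' L' : Type) (F : set (set L)) :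
  Chang K L K' L' -> [set: L] #<= [set: K] -> [set: K] #<= F ->
  exists2 X : set L, X #= [set: L'] & [set: K'] #<= restr F X.
Proof.
move=> chang /card_leT_inj[e eI]; rewrite (card_le_eqr (Defs.card_sig F)).
move=> /card_leT_inj[h hI].
pose g k : set L := sval (h k).
have gI : injective g.
  move=> a b; rewrite /g => gab; apply: hI.
  case: (h a) (h b) gab => [s Fs] [t Ft] /= st.
  by subst t; congr exist; exact: Prop_irrelevance.
pose M := membership_structure e g.
pose P : rsym membership_language 1 := tt.
have [] := chang _ countable_membership_language K M P.
- exact: card_eqxx.
- by apply: inj_card_eq => x y _ _; exact: eI.
move=> S [elS SK' SL'].
pose X := e @^-1` S.
have eX : e @` X = S `&` interp1 M P.
  apply/seteqP; split=> [_ [x Xx <-]|k [Sk [x _ ek]]].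
    by split=> //; exists x.
  by exists x => //; rewrite /X /= ek.
exists X.
  have XE : e @` X #= X by apply: inj_card_eq => x y _ _; exact: eI.
  by rewrite -(card_eql XE) eX.
have gXI : {in S &, injective (fun k => g k `&` X)}.
  have sub a b : S a -> S b -> g a `&` X = g b `&` X -> g a `<=` g b.
    move=> Sa Sb ab x ax; apply: contrapT => nbx.
    have [y [Sy ay nby]] := elementary_sub_separates eI elS Sa Sb ax nbx.
    by have : (g a `&` X) y by []; rewrite ab => -[].
  move=> a b; rewrite !inE => Sa Sb ab; apply: gI.
  by apply/seteqP; split; exact: sub.
rewrite -(card_le_eql SK') -(card_le_eql (inj_card_eq gXI)).
apply: subset_card_le => _ [k Sk <-]; exists (g k) => //.
exact: svalP (h k).
Qed.

(** Minimality of the successor speaks of types, so [B] is replaced by its subtype. *)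
Lemma succ_card_le (T U : Type) (B : set U) :
  card_lt [set: T] B -> [set: succ_card T] #<= B.
Proof.
have [_ least] := succ_cardP T; move=> [TB nBT].
rewrite (card_le_eqr (Defs.card_sig B)); apply: least; split.
  by rewrite -(card_le_eqr (Defs.card_sig B)).
by rewrite -(card_le_eql (Defs.card_sig B)).
Qed.

Theorem theorem3p1 :
  GCH -> Chang aleph_omega1 aleph_omega (aleph 1) (aleph 0) ->
  ~ KH aleph_omega /\
  ~ (exists F : set (set aleph_omega),
       [/\ forall t, F t -> t #= [set: aleph 0],
           [set: aleph_omega1] #<= F &
           forall X : set aleph_omega, X #= [set: aleph 0] ->
             restr F X #= [set: aleph 0]]).
Proof.
move=> _ chang.
have [[ww1 _] _] := succ_cardP aleph_omega.
have [[_ n10] _] := succ_cardP (aleph 0).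
split=> [[F [ltF restrF]]|[F [_ leF restrF]]].
  have [X X0 leX] := Chang_restr_ge chang ww1 (succ_card_le ltF).
  apply: (n10); rewrite -(card_le_eqr X0); apply: card_le_trans leX _.
  apply: restrF.
    by rewrite (eq_finite_set X0); exact: infinite_nat.
  (* [X] is strictly smaller than [aleph_omega]: otherwise [aleph 1] would embed into [aleph 0]. *)
  have [le_w _] := aleph_omegaP.
  split; first by rewrite (card_le_eql X0); exact: (le_w 0).
  rewrite (card_le_eqr X0) => w0; apply: n10.
  exact: card_le_trans (le_w 1) w0.
have [X X0 leX] := Chang_restr_ge chang ww1 leF.
by apply: (n10); rewrite -(card_le_eqr (restrF X X0)).
Qed.
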